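(* Suppose the tube MPC problem $\mathrm{TMPC}(\hat x_0,\hat\theta_0,y^{\mathrm r}_0)$ (defined in the context) is feasible for the initial state-parameter estimate $(\hat x_0,\hat\theta_0)$. Let $\{y^{\mathrm r}_t\}_{t\in\mathbb N}\subseteq\mathbb R^{n_y}$ be any reference sequence and $\{u^{\mathrm p}_t\}_{t\in\mathbb N}\subseteq\beta\mathbb U$ any perturbation sequence, and let $(\hat x_t,\hat\theta_t)_{t\in\mathbb N}$ be generated by the closed-loop scheme described in the context, in which the estimator is constrained so that for all $t$ $$(\hat x_{t+1},\hat\theta_{t+1})\in\Theta\big(\mathbf x^*(\hat x_t,\hat\theta_t,y^{\mathrm r}_t),\,d(\hat\theta_t)\big).$$ Then $\mathrm{TMPC}(\hat x_t,\hat\theta_t,y^{\mathrm r}_t)$ is feasible for all $t\in\mathbb N$.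
   Context: **Notation.** $\mathbb I_n^m$ is the set of integers from $n$ to $m$; $\Delta_n=\{x\in[0,1]^n:\sum_i x_i=1\}$; $|\cdot|$ of a vector or matrix is elementwise absolute value; vector inequalities and maxima are elementwise; $\|x\|_M^2=x^\top Mx$; $\mathrm{CH}$ denotes convex hull. **Data.** $\mathbb U=\{u\in\mathbb R^{n_u}:|u|\le\epsilon^u\}$ with a given $\epsilon^u\ge 0$; $\mathbb Y\subseteq\mathbb R^{n_y}$ is a given convex polyhedral set; $\beta\in[0,1)$, $\gamma\in(0,1)$, $N\in\mathbb N$ (horizon) are fixed; $C\in\mathbb R^{n_y\times n_x}$ is fixed with full row rank. **Model.** $\theta$ collects matrices $A_i\in\mathbb R^{n_x\times n_x}$, $B_i\in\mathbb R^{n_x\times n_u}$, $i\in\mathbb I_1^{n_p}$, and the parameters of a feedforward neural network $\mathcal N:\mathbb R^{n_x+n_u}\to\mathbb R^{n_p}$ with continuously differentiable activations. With $p(x,u)=\mathrm{softmax}(\mathcal N(x,u))\in\Delta_{n_p}$, $f(x,u,\theta)=\sum_i p_i(x,u)(A_ix+B_iu)$. **Polytopes.** $F\in\mathbb R^{\mathsf f\times n_x}$ is fixed, $X(z,s)=z\oplus\{x\in\mathbb R^{n_x}:Fx\le s\}$. A matrix $E$ and matrices $V_j\in\mathbb R^{n_x\times\mathsf f}$, $j\in\mathbb I_1^{\mathsf v}$, are fixed such that, with $\mathcal E=\{s\in\mathbb R^{\mathsf f}:s\ge0,\ Es\le0\}$, one has $X(z,s)=\mathrm{CH}\{z+V_js,\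 j\in\mathbb I_1^{\mathsf v}\}$ for all $z\in\mathbb R^{n_x}$, $s\in\mathcal E$. For $c=(c_1,\dots,c_{\mathsf v})\in\mathbb R^{\mathsf v n_u}$, $U_jc=c_j\in\mathbb R^{n_u}$. **RCI inequalities.** For $\theta$ define $d(\theta)=\max\{\beta|FB_i|\epsilon^u,\ i\in\mathbb I_1^{n_p}\}$. A tuple $\mathbf x^{\mathrm r}=(z^{\mathrm s},v^{\mathrm s},s,c,q)$ with $z^{\mathrm s}\in\mathbb R^{n_x}$, $v^{\mathrm s}\in\mathbb R^{n_u}$, $s,q\in\mathbb R^{\mathsf f}$, $c\in\mathbb R^{\mathsf v n_u}$ satisfies the RCI inequalities for $\theta$ if for all $(i,j)\in\mathbb I_1^{n_p}\times\mathbb I_1^{\mathsf v}$: $F(A_i(z^{\mathrm s}+V_js)+B_i(v^{\mathrm s}+U_jc))+d(\theta)+q\le s+Fz^{\mathrm s}$, $C(z^{\mathrm s}+V_js)\in\mathbb Y$, $v^{\mathrm s}+U_jc\in(1-\beta)\mathbb U$, $q\ge0$, $s\in\mathcal E$. **Problem $\mathrm{TMPC}(\hat x,\hat\theta,y^{\mathrm r})$.** Minimize over $\mathbf x=(z_0,v_0,\dots,z_N,v_N,\mathbf x^{\mathrm r})$ the cost $$\sum_{k=0}^{N-1}\left\|\begin{bmatrix}z_k-z^{\mathrm s}\\ v_k-v^{\mathrm s}\end{bmatrix}\right\|_Q^2+\left\|\begin{bmatrix}z_N-z^{\mathrm s}\\ v_N-v^{\mathrm s}\end{bmatrix}\right\|_P^2+\ell(\mathbf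 x^{\mathrm r},y^{\mathrm r})$$ subject to, with $A_i,B_i$ taken from $\hat\theta$, for all $(i,j,k)\in\mathbb I_1^{n_p}\times\mathbb I_1^{\mathsf v}\times\mathbb I_0^{N-1}$: - $F(A_i(z_k-z^{\mathrm s})+B_i(v_k-v^{\mathrm s}))\le q+F(z_{k+1}-z^{\mathrm s})$, $C(z_k+V_js)\in\mathbb Y$, $v_k+U_jc\in(1-\beta)\mathbb U$; - $F(A_i(z_N-z^{\mathrm s})+B_i(v_N-v^{\mathrm s}))\le q+\gamma F(z_N-z^{\mathrm s})$, $C(z_N+V_js)\in\mathbb Y$, $v_N+U_jc\in(1-\beta)\mathbb U$; - $F\hat x\le s+Fz_0$; and $\mathbf x^{\mathrm r}$ satisfies the RCI inequalities for $\hat\theta$. The problem is a convex quadratic program; $\ell$ is a convex quadratic cost, e.g. $\ell(\mathbf x^{\mathrm r},y^{\mathrm r})=\sum_{j=1}^{\mathsf v}\|y^{\mathrm r}-Cz^{\mathrm s}\|_{Q_1}^2+\|\mathbf x^{\mathrm r}\|_{Q_2}^2$ with $Q_1,Q_2\succ0$. Its optimizer is $\mathbf x^*(\hat x,\hat\theta,y^{\mathrm r})$, with components denoted by $*$. **Set $\Theta(\mathbf x,d)$.** For $\mathbf x=(z_0,v_0,\dots,z_N,v_N,z^{\mathrm s},v^{\mathrm s},s,c,q)$ and $d\in\mathbb R^{\mathsf f}$, put $z^+=z^{\mathrm s}+\gamma(z_N-z^{\mathrm s})$, $v^+=v^{\mathrm s}+\gamma(v_N-v^{\mathrm s})$. $\Theta(\mathbf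 x,d)$ is the set of $(x,\theta)$ such that, with $A_i,B_i$ from $\theta$, for all $(i,j,k)\in\mathbb I_1^{n_p}\times\mathbb I_1^{\mathsf v}\times\mathbb I_1^{N-1}$: - $Fx\le s+Fz_1$, $\beta|FB_i|\epsilon^u\le d$; - $F(A_i(z_k-z^{\mathrm s})+B_i(v_k-v^{\mathrm s}))\le q+F(z_{k+1}-z^{\mathrm s})$; - $F(A_i(z_N-z^{\mathrm s})+B_i(v_N-v^{\mathrm s}))\le q+F(z^+-z^{\mathrm s})$; - $F(A_i(z^+-z^{\mathrm s})+B_i(v^+-v^{\mathrm s}))\le q+\gamma F(z^+-z^{\mathrm s})$; - $F(A_i(z^{\mathrm s}+V_js)+B_i(v^{\mathrm s}+U_jc))\le s+Fz^{\mathrm s}-(d+q)$. **Closed-loop scheme.** At time $t$, solve $\mathrm{TMPC}(\hat x_t,\hat\theta_t,y^{\mathrm r}_t)$; let $\lambda$ minimize $\|\lambda\|_2^2$ over $\lambda\in\Delta_{\mathsf v}$ with $\hat x_t=z_0^*+\sum_j\lambda_jV_js^*$; apply $u_t=v_0^*+\sum_{j=1}^{\mathsf v}\lambda_jc_j^*+u^{\mathrm p}_t$ with some $u^{\mathrm p}_t\in\beta\mathbb U$ to an unknown plant. An estimator then computes $(\hat x_{t+1},\hat\theta_{t+1})=\hat F(u_{0:t},y_{0:t+1})$ from past inputs $u_{0:t}$ and measured plant outputs $y_{0:t+1}$; the estimator is arbitrary apart from the requirement that its output lie in the prescribed constraint set. *)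

(* Defs.v *)
From HB Require Import structures.
From mathcomp Require Import all_boot all_order all_algebra.
From mathcomp Require Import all_classical all_reals all_analysis.
Import Order.TTheory GRing.Theory Num.Theory.
Import numFieldNormedType.Exports.

Set Implicit Arguments.
Unset Strict Implicit.
Unset Printing Implicit Defensive.

Local Open Scope classical_set_scope.
Local Open Scope ring_scope.

Definition vle (R : realType) (n : nat) (u v : 'cV[R]_n) : Prop :=
  forall i, u i 0 <= v i 0.

Notation "u '<=v' v" := (vle u v) (at level 70, no associativity) : ring_scope.

Definition mxabs (R : realType) (m n : nat) (A : 'M[R]_(m, n)) : 'M[R]_(m, n) :=
  map_mx Num.norm A.

Definition sqnorm_wrt (R : realType) (n : nat) (M : 'M[R]_n) (x : 'cV[R]_n) : R :=
  (x^T *m M *m x) 0 0.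

Definition sym_psd (R : realType) (n : nat) (M : 'M[R]_n) : Prop :=
  M^T = M /\ forall x, 0 <= sqnorm_wrt M x.

Definition simplex (R : realType) (n : nat) : set 'cV[R]_n :=
  [set l | (forall i, 0 <= l i 0 <= 1) /\ \sum_i l i 0 = 1].

Definition convex_hull (R : realType) (n k : nat) (p : 'I_k -> 'cV[R]_n) :
    set 'cV[R]_n :=
  [set \sum_j l j 0 *: p j | l in @simplex R k].

Definition scale_set (R : realType) (n : nat) (a : R) (S : set 'cV[R]_n) :
    set 'cV[R]_n :=
  [set a *: x | x in S].

Definition polyhedral (R : realType) (n : nat) (S : set 'cV[R]_n) : Prop :=
  exists (m : nat) (H : 'M[R]_(m, n)) (h : 'cV[R]_m),
    S = [set y | H *m y <=v h].

Record problem (R : realType) (T : Type) := Problem {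
  constraints : set T;
  objective : T -> R }.

Definition feasible (R : realType) (T : Type) (p : problem R T) : Prop :=
  exists x, constraints p x.

Definition optimizer (R : realType) (T : Type) (p : problem R T) (x : T) : Prop :=
  constraints p x /\
  forall x', constraints p x' -> objective p x <= objective p x'.

Definition continuously_differentiable (R : realType) (g : R -> R) : Prop :=
  (forall x, derivable g x 1) /\ continuous (derive1 g).

Fixpoint net_params (R : realType) (n_in : nat) (hidden : seq (nat * (R -> R)))
    (n_out : nat) : Type :=
  match hidden with
  | [::] => ('M[R]_(n_out, n_in) * 'cV[R]_n_out)%type
  | h :: hidden' =>
      ('M[R]_(h.1, n_in) * 'cV[R]_h.1 * net_params h.1 hidden' n_out)%type
  end.

(* Each hidden layer is an affine map followed by its activation, applied
   entrywise; the output layer is affine. *)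
Fixpoint net_eval (R : realType) (n_in : nat) (hidden : seq (nat * (R -> R)))
    (n_out : nat) :
    net_params n_in hidden n_out -> 'cV[R]_n_in -> 'cV[R]_n_out :=
  match hidden return net_params n_in hidden n_out -> _ with
  | [::] => fun w x => w.1 *m x + w.2
  | h :: hidden' => fun w x =>
      @net_eval R h.1 hidden' n_out w.2
        (map_mx h.2 (w.1.1 *m x + w.1.2))
  end.

Definition softmax (R : realType) (n : nat) (y : 'cV[R]_n) : 'cV[R]_n :=
  \col_i (expR (y i 0) / \sum_j expR (y j 0)).

(* The tuple x^r = (z^s, v^s, s, c, q). *)
Record rci_tuple (R : realType) (nx nu nf nv : nat) := RciTuple {
  zs : 'cV[R]_nx;
  vs : 'cV[R]_nu;
  ss : 'cV[R]_nf;
  cs : 'cV[R]_(nv * nu);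
  qs : 'cV[R]_nf }.

Definition rci_vec (R : realType) (nx nu nf nv : nat)
    (r : rci_tuple R nx nu nf nv) : 'cV[R]_(nx + (nu + (nf + (nv * nu + nf)))) :=
  col_mx (zs r) (col_mx (vs r) (col_mx (ss r) (col_mx (cs r) (qs r)))).

Definition convex_quadratic (R : realType) (nx nu nf nv : nat)
    (l : rci_tuple R nx nu nf nv -> R) : Prop :=
  exists (H : 'M[R]_(nx + (nu + (nf + (nv * nu + nf)))))
         (g : 'cV[R]_(nx + (nu + (nf + (nv * nu + nf))))) (a : R),
    sym_psd H /\
    forall r, l r = sqnorm_wrt H (rci_vec r) + (g^T *m rci_vec r) 0 0 + a.

(* U_j c = c_j : vec_mx reads the row vector c^T as the nv x nu matrix whose
   j-th row is c_j^T. *)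
Definition block (R : realType) (nv nu : nat) (j : 'I_nv) (c : 'cV[R]_(nv * nu)) :
    'cV[R]_nu :=
  (row j (vec_mx c^T))^T.

Record tmpc_data (R : realType) := TmpcData {
  nx : nat; nu : nat; ny : nat; np : nat;
  nf : nat;  (* rows of F *)
  nv : nat;  (* number of vertex maps V_j *)
  ne : nat;  (* rows of E *)
  horizon : nat;
  epsu : 'cV[R]_nu;
  Yset : set 'cV[R]_ny;
  beta : R;
  gamma : R;
  Cmx : 'M[R]_(ny, nx);
  Fmx : 'M[R]_(nf, nx);
  Emx : 'M[R]_(ne, nf);
  Vmx : 'I_nv -> 'M[R]_(nx, nf);
  Qmx : 'M[R]_(nx + nu);
  Pmx : 'M[R]_(nx + nu);
  ell : rci_tuple R nx nu nf nv -> 'cV[R]_ny -> R;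
  (* widths and activations of the hidden layers *)
  hidden : seq (nat * (R -> R)) }.

Arguments Yset {R} t.
Arguments Vmx {R} t.
Arguments ell {R} t.
Arguments hidden {R} t.

Definition Uset (R : realType) (D : tmpc_data R) : set 'cV[R]_(nu D) :=
  [set u | mxabs u <=v epsu D].

Arguments Uset {R} D.

Definition Xset (R : realType) (D : tmpc_data R) (z : 'cV[R]_(nx D))
    (s : 'cV[R]_(nf D)) : set 'cV[R]_(nx D) :=
  [set z + x | x in [set x | Fmx D *m x <=v s]].

Definition Eset (R : realType) (D : tmpc_data R) : set 'cV[R]_(nf D) :=
  [set s | 0 <=v s /\ Emx D *m s <=v 0].

(* n_p >= 1 because softmax takes values in the simplex of R^{n_p};
   horizon >= 1 because Theta(x, d) refers to z_1. *)
Record standing_assumptions (R : realType) (D : tmpc_data R) : Prop := {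
  np_gt0 : (0 < np D)%N;
  horizon_gt0 : (0 < horizon D)%N;
  epsu_ge0 : 0 <=v epsu D;
  Y_polyhedral : polyhedral (Yset D);
  beta_bounds : 0 <= beta D < 1;
  gamma_bounds : 0 < gamma D < 1;
  C_full_row_rank : row_free (Cmx D);
  vertex_maps : forall z s, Eset s ->
    Xset z s = convex_hull (fun j => z + Vmx D j *m s);
  Q_psd : sym_psd (Qmx D);
  P_psd : sym_psd (Pmx D);
  ell_convex_quadratic : forall yr, convex_quadratic (fun r => ell D r yr);
  activations_C1 : forall k, (k < size (hidden D))%N ->
    continuously_differentiable (nth (0%N, id) (hidden D) k).2 }.

Record theta (R : realType) (D : tmpc_data R) := Theta_ {
  Amx : 'I_(np D) -> 'M[R]_(nx D);
  Bmx : 'I_(np D) -> 'M[R]_(nx D, nu D);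
  net : net_params (nx D + nu D) (hidden D) (np D) }.

(* The prediction model f(x, u, theta).  The plant being unknown, f enters the
   tube MPC scheme only through the matrices A_i, B_i. *)
Definition model (R : realType) (D : tmpc_data R) (x : 'cV[R]_(nx D))
    (u : 'cV[R]_(nu D)) (th : theta D) : 'cV[R]_(nx D) :=
  \sum_i softmax (net_eval (net th) (col_mx x u)) i 0 *:
    (Amx th i *m x + Bmx th i *m u).

(* The maximum is over n_p >= 1 nonnegative numbers, so the base value 0 is
   harmless. *)
Definition dvec (R : realType) (D : tmpc_data R) (th : theta D) : 'cV[R]_(nf D) :=
  \col_r \big[Num.max/0]_i
    (beta D *: (mxabs (Fmx D *m Bmx th i) *m epsu D)) r 0.

Definition rci_inequalities (R : realType) (D : tmpc_data R) (th : theta D)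
    (r : rci_tuple R (nx D) (nu D) (nf D) (nv D)) : Prop :=
  (forall i j,
    [/\ Fmx D *m (Amx th i *m (zs r + Vmx D j *m ss r)
                  + Bmx th i *m (vs r + block j (cs r))) + dvec th + qs r
          <=v ss r + Fmx D *m zs r,
        Yset D (Cmx D *m (zs r + Vmx D j *m ss r)) &
        scale_set (1 - beta D) (Uset D) (vs r + block j (cs r))]) /\
  0 <=v qs r /\ Eset (ss r).

(* (z_0, v_0, ..., z_N, v_N, x^r) *)
Record decision (R : realType) (D : tmpc_data R) := Decision {
  zd : 'I_(horizon D).+1 -> 'cV[R]_(nx D);
  vd : 'I_(horizon D).+1 -> 'cV[R]_(nu D);
  xr : rci_tuple R (nx D) (nu D) (nf D) (nv D) }.

(* For k < N, the positions k and k + 1 in {0, ..., N}. *)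
Definition cur (N : nat) (k : 'I_N) : 'I_N.+1 := widen_ord (leqnSn N) k.
Definition nxt (N : nat) (k : 'I_N) : 'I_N.+1 := lift ord0 k.

Definition tmpc_cost (R : realType) (D : tmpc_data R) (yr : 'cV[R]_(ny D))
    (x : decision D) : R :=
  \sum_(k < horizon D)
    sqnorm_wrt (Qmx D) (col_mx (zd x (cur k) - zs (xr x))
                               (vd x (cur k) - vs (xr x)))
  + sqnorm_wrt (Pmx D) (col_mx (zd x ord_max - zs (xr x))
                               (vd x ord_max - vs (xr x)))
  + ell D (xr x) yr.

Definition tmpc_constraints (R : realType) (D : tmpc_data R)
    (xhat : 'cV[R]_(nx D)) (th : theta D) : set (decision D) :=
  [set x |
    let r := xr x in
    [/\ forall (i : 'I_(np D)) (k : 'I_(horizon D)),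
          Fmx D *m (Amx th i *m (zd x (cur k) - zs r)
                    + Bmx th i *m (vd x (cur k) - vs r))
            <=v qs r + Fmx D *m (zd x (nxt k) - zs r),
        forall i : 'I_(np D),
          Fmx D *m (Amx th i *m (zd x ord_max - zs r)
                    + Bmx th i *m (vd x ord_max - vs r))
            <=v qs r + gamma D *: (Fmx D *m (zd x ord_max - zs r)),
        (* stages 0, ..., N - 1 and the terminal stage N together *)
        forall (j : 'I_(nv D)) (k : 'I_(horizon D).+1),
          Yset D (Cmx D *m (zd x k + Vmx D j *m ss r)) /\
          scale_set (1 - beta D) (Uset D) (vd x k + block j (cs r)),
        Fmx D *m xhat <=v ss r + Fmx D *m zd x ord0 &
        rci_inequalities th r]].

Definition TMPC (R : realType) (D : tmpc_data R) (xhat : 'cV[R]_(nx D))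
    (th : theta D) (yr : 'cV[R]_(ny D)) : problem R (decision D) :=
  Problem (tmpc_constraints xhat th) (tmpc_cost yr).

Definition Theta_set (R : realType) (D : tmpc_data R) (x : decision D)
    (d : 'cV[R]_(nf D)) : set ('cV[R]_(nx D) * theta D) :=
  [set p |
    let r := xr x in
    let zN := zd x ord_max in
    let vN := vd x ord_max in
    let zp := zs r + gamma D *: (zN - zs r) in
    let vp := vs r + gamma D *: (vN - vs r) in
    let A := Amx p.2 in
    let B := Bmx p.2 in
    Fmx D *m p.1 <=v ss r + Fmx D *m zd x (inord 1) /\
    forall i : 'I_(np D),
      [/\ beta D *: (mxabs (Fmx D *m B i) *m epsu D) <=v d,
          forall k : 'I_(horizon D), (1 <= k)%N ->
            Fmx D *m (A i *m (zd x (cur k) - zs r)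
                      + B i *m (vd x (cur k) - vs r))
              <=v qs r + Fmx D *m (zd x (nxt k) - zs r),
          Fmx D *m (A i *m (zN - zs r) + B i *m (vN - vs r))
            <=v qs r + Fmx D *m (zp - zs r),
          Fmx D *m (A i *m (zp - zs r) + B i *m (vp - vs r))
            <=v qs r + gamma D *: (Fmx D *m (zp - zs r)) &
          forall j : 'I_(nv D),
            Fmx D *m (A i *m (zs r + Vmx D j *m ss r)
                      + B i *m (vs r + block j (cs r)))
              <=v ss r + Fmx D *m zs r - (d + qs r)]].

Definition lambda_problem (R : realType) (D : tmpc_data R)
    (xhat : 'cV[R]_(nx D)) (x : decision D) : problem R 'cV[R]_(nv D) :=
  Problem
    [set l | simplex l /\
       xhat = zd x ord0 + \sum_j l j 0 *: (Vmx D j *m ss (xr x))]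
    (fun l => \sum_j l j 0 ^+ 2).

(* The plant is an arbitrary causal map: y_t is a function of (u_0, ..., u_{t-1}),
   disturbances being absorbed in the map.  The optimality conditions on x*_t and
   lambda_t are imposed only at the times at which the MPC problem is feasible,
   so that being generated by the scheme does not presuppose feasibility. *)
Record closed_loop (R : realType) (D : tmpc_data R)
    (plant : seq 'cV[R]_(nu D) -> 'cV[R]_(ny D))
    (estimator : seq 'cV[R]_(nu D) -> seq 'cV[R]_(ny D) ->
                 'cV[R]_(nx D) * theta D)
    (yr : nat -> 'cV[R]_(ny D)) (up : nat -> 'cV[R]_(nu D))
    (xhat : nat -> 'cV[R]_(nx D)) (th : nat -> theta D)
    (xstar : nat -> decision D) (lambda : nat -> 'cV[R]_(nv D))
    (u : nat -> 'cV[R]_(nu D)) (y : nat -> 'cV[R]_(ny D)) : Prop := {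
  loop_optimizer : forall t, feasible (TMPC (xhat t) (th t) (yr t)) ->
    optimizer (TMPC (xhat t) (th t) (yr t)) (xstar t);
  loop_lambda : forall t, feasible (TMPC (xhat t) (th t) (yr t)) ->
    optimizer (lambda_problem (xhat t) (xstar t)) (lambda t);
  loop_input : forall t,
    u t = vd (xstar t) ord0
          + \sum_j lambda t j 0 *: block j (cs (xr (xstar t))) + up t;
  loop_output : forall t, y t = plant (mkseq u t);
  loop_estimate : forall t,
    (xhat t.+1, th t.+1) = estimator (mkseq u t.+1) (mkseq y t.+2) }.

(* Main.v *)
(* The previous optimizer, shifted by one step and extended by the point
   (z^+, v^+) at distance gamma from (z^s, v^s), is feasible for the new
   estimate.  The set Theta contains exactly the inequalities of the shifted
   problem that involve the new matrices; those that do not involve them hold by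
   convexity, (z^+, v^+) being a convex combination of (z_N, v_N) and
   (z^s, v^s).  Since Theta also forces d(theta) not to increase, the RCI tuple
   can be kept. *)
Require Import Defs.
From mathcomp Require Import all_boot all_order all_algebra.
From mathcomp Require Import all_classical all_reals all_analysis.
From mathcomp Require Import ring lra.
Import Order.TTheory GRing.Theory Num.Theory.

Set Implicit Arguments.
Unset Strict Implicit.
Unset Printing Implicit Defensive.

Local Open Scope classical_set_scope.
Local Open Scope ring_scope.

(** Under the test [k < N] the index [k.+1] is at most [N], so [inord] never falls back on its
    default. *)
Definition shift_append (T : Type) (N : nat) (a : 'I_N.+1 -> T) (b : T)
    (k : 'I_N.+1) : T :=
  if (k < N)%N then a (inord k.+1) else b.

Lemma shift_append_cur (T : Type) (N : nat) (a : 'I_N.+1 -> T) (b : T)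
    (k : 'I_N) : shift_append a b (cur k) = a (nxt k).
Proof.
rewrite /shift_append /= ltn_ord; congr a; apply: val_inj.
by rewrite /= inordK // ltnS.
Qed.

Lemma shift_append_max (T : Type) (N : nat) (a : 'I_N.+1 -> T) (b : T) :
  shift_append a b ord_max = b.
Proof. by rewrite /shift_append /= ltnn. Qed.

Lemma shift_append_ord0 (T : Type) (N : nat) (a : 'I_N.+1 -> T) (b : T) :
  (0 < N)%N -> shift_append a b ord0 = a (inord 1).
Proof. by rewrite /shift_append /= => ->. Qed.

(** Separates the last transition, which ends at the appended point, from the transitions of the old
    sequence that start at an index [l >= 1], the range covered by [Theta_set]. *)
Lemma nxtP (N : nat) (k : 'I_N) :
  nxt k = ord_max \/ exists2 l : 'I_N, (0 < l)%N & nxt k = cur l.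
Proof.
have := ltn_ord k; rewrite leq_eqVlt => /orP[/eqP kN|kN].
  by left; apply: val_inj.
by right; exists (Ordinal kN) => //; apply: val_inj.
Qed.

Section convexity.
Variables (R : realType) (g : R).
Hypothesis g01 : 0 <= g <= 1.

Lemma polyhedral_conv (n : nat) (S : set 'cV[R]_n) (a b : 'cV[R]_n) :
  polyhedral S -> S a -> S b -> S (a + g *: (b - a)).
Proof.
move=> [m [H [h ->]]] /= Ha Hb i.
move: (Ha i) (Hb i); rewrite mulmxDr -scalemxAr mulmxBr.
move: (H *m a) (H *m b) => Ha' Hb'; rewrite !mxE.
by move: g01 => /andP[]; nra.
Qed.

Lemma scale_Uset_conv (D : tmpc_data R) (r : R) (a b : 'cV[R]_(nu D)) :
  scale_set r (Uset D) a -> scale_set r (Uset D) b ->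
  scale_set r (Uset D) (a + g *: (b - a)).
Proof.
(* The combination is formed on the unscaled preimages, where the bound by [epsu] applies
   directly. *)
move=> [a' Ha <-] [b' Hb <-]; exists (a' + g *: (b' - a')); last first.
  by apply/matrixP => i j; rewrite !mxE; ring.
move=> i; have := Ha i; have := Hb i; rewrite !mxE !ler_norml.
by move: g01 => /andP[? ?] /andP[? ?] /andP[? ?]; apply/andP; split; nra.
Qed.

End convexity.

Lemma dvec_le (R : realType) (D : tmpc_data R) (th th' : theta D) :
  (forall i, beta D *: (mxabs (Fmx D *m Bmx th' i) *m epsu D) <=v dvec th) ->
  dvec th' <=v dvec th.
Proof.
move=> le_d r; rewrite mxE; apply/bigmax_leP; split=> [|i _]; last exact: le_d.
(* The base value 0 of the maximum must be bounded too: [dvec th] is itself a maximum over base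
   0. *)
by rewrite mxE bigmax_ge_id.
Qed.

Definition shifted_decision (R : realType) (D : tmpc_data R) (x : decision D) :
    decision D :=
  let r := xr x in
  {| zd := shift_append (zd x) (zs r + gamma D *: (zd x ord_max - zs r));
     vd := shift_append (vd x) (vs r + gamma D *: (vd x ord_max - vs r));
     xr := r |}.

(** [Theta_set] gives the vertex inequality with margin [dvec th], and replacing it by the smaller
    [dvec th'] only relaxes it. The remaining conditions do not involve the parameters. *)
Lemma rci_inequalities_update (R : realType) (D : tmpc_data R) (x : decision D)
    (th : theta D) (xhat' : 'cV[R]_(nx D)) (th' : theta D) :
  rci_inequalities th (xr x) -> Theta_set x (dvec th) (xhat', th') ->
  rci_inequalities th' (xr x).
Proof.
move=> [rci rest] [_ upd]; split=> // i j; have [_ HY HU] := rci i j.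
split=> // r; have [_ _ _ _ /(_ j r)] := upd i.
have /(_ r) : dvec th' <=v dvec th by apply: dvec_le => l; case: (upd l).
move: (dvec th') (dvec th) (_ *m (_ + _)) => d' d M; rewrite !mxE; lra.
Qed.

Lemma shifted_decision_feasible (R : realType) (D : tmpc_data R)
    (hD : standing_assumptions D) (x : decision D)
    (xhat xhat' : 'cV[R]_(nx D)) (th th' : theta D) :
  tmpc_constraints xhat th x -> Theta_set x (dvec th) (xhat', th') ->
  tmpc_constraints xhat' th' (shifted_decision x).
Proof.
move=> [_ _ stage _ rci] upd.
have rci' := rci_inequalities_update rci upd.
have [init dyn] := upd.
have g01 : 0 <= gamma D <= 1 by have /andP[/ltW -> /ltW] := gamma_bounds hD.
split=> /=.
- move=> i k; have [_ dynk dynN _ _] := dyn i.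
  (* For the last [k] the transition runs from [z_N] to [z^+], which is [dynN]; otherwise it is an
     old transition starting at [l >= 1]. *)
  rewrite !shift_append_cur; have [->|[l l_gt0 ->]] := nxtP k.
    by rewrite !shift_append_max.
  by rewrite !shift_append_cur; apply: dynk.
- by move=> i; rewrite !shift_append_max; have [] := dyn i.
- move=> j k; rewrite /shift_append; case: ifP => _; first exact: stage.
  (* The constraints at [z^s] are stated for each pair [(i, j)], so some index [i] is required;
     [np_gt0] provides it. *)
  have [_ Ys Us] := rci.1 (Ordinal (np_gt0 hD)) j.
  have [YN UN] := stage j ord_max; split.
    have := polyhedral_conv g01 (Y_polyhedral hD) Ys YN.
    rewrite -mulmxBr scalemxAr -mulmxDr.
    by congr (Yset D (_ *m _)); apply/matrixP => a b; rewrite !mxE; ring.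
  have := scale_Uset_conv g01 Us UN.
  by congr (scale_set _ _ _); apply/matrixP => a b; rewrite !mxE; ring.
- by rewrite shift_append_ord0 //; apply: horizon_gt0.
- exact: rci'.
Qed.

Theorem lemma1 (R : realType) (D : tmpc_data R) (hD : standing_assumptions D)
  (plant : seq 'cV[R]_(nu D) -> 'cV[R]_(ny D))
  (estimator : seq 'cV[R]_(nu D) -> seq 'cV[R]_(ny D) ->
               'cV[R]_(nx D) * theta D)
  (yr : nat -> 'cV[R]_(ny D)) (up : nat -> 'cV[R]_(nu D))
  (xhat : nat -> 'cV[R]_(nx D)) (th : nat -> theta D)
  (xstar : nat -> decision D) (lambda : nat -> 'cV[R]_(nv D))
  (u : nat -> 'cV[R]_(nu D)) (y : nat -> 'cV[R]_(ny D))
  (hinit : feasible (TMPC (xhat 0%N) (th 0%N) (yr 0%N)))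
  (hup : forall t : nat, scale_set (beta D) (Uset D) (up t))
  (hloop : closed_loop plant estimator yr up xhat th xstar lambda u y)
  (hest : forall t : nat,
     Theta_set (xstar t) (dvec (th t)) (xhat t.+1, th t.+1)) :
  forall t : nat, feasible (TMPC (xhat t) (th t) (yr t)).
Proof.
elim=> [//|t feas_t].
(* The scheme yields an optimizer only at feasible times, hence the induction. The constraints do
   not depend on the reference, so its change is harmless. *)
have [opt_t _] := loop_optimizer hloop feas_t.
by exists (shifted_decision (xstar t)); apply: shifted_decision_feasible opt_t _.
Qed.
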